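(* Let $n\ge 34$ be an even integer and let $D_n=2\lceil n/4\rceil-1$. There exists a graph of order $n$ in which every vertex has degree $D_n$ or $D_n+1$, and whose maximum number of pairwise edge-disjoint perfect matchings is exactly $\lceil n/4\rceil$.
   Context: All graphs are finite, simple, and undirected. *)

(* Defs.v *)
From mathcomp Require Import all_boot.
Set Implicit Arguments.
Unset Strict Implicit.
Unset Printing Implicit Defensive.

Record sgraph := SGraph {
  vertex :> finType;
  adj : rel vertex;
  adj_sym : symmetric adj;
  adj_irr : irreflexive adj
}.

Definition degree (G : sgraph) (v : G) : nat := #|[set w : G | adj v w]|.

Definition edges (G : sgraph) : {set {set G}} :=
  [set [set x; y] | x in G, y in G & adj x y].

Definition perfect_matching (G : sgraph) (M : {set {set G}}) : bool :=
  [&& M \subset edges G, trivIset M & cover M == [set: G]].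

(* Members of [F] are distinct sets of edges, and [trivIset F] makes them
   pairwise disjoint as such. *)
Definition disjoint_perfect_matchings (G : sgraph)
    (F : {set {set {set G}}}) : bool :=
  [forall M in F, perfect_matching M] && trivIset F.

Definition max_disjoint_perfect_matchings (G : sgraph) : nat :=
  \max_(F : {set {set {set G}}} | disjoint_perfect_matchings F) #|F|.

Definition ceil_div (m d : nat) : nat := (m + d.-1) %/ d.

Definition D (n : nat) : nat := 2 * ceil_div n 4 - 1.

(* Main.v *)
(** Take a graph [H] on [A] and an independent set [B] with [#|A| = #|B| + 2],
    and join some vertices of [A] to some vertices of [B].  As [A] is larger
    than its complement, every perfect matching uses an edge of [H], so there
    are at most [#|edges H|] disjoint ones.  Conversely, an edge [p] of [H] and
    an injection of [B] into [A] which avoids [p] and follows edges make up a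
    perfect matching.

    For the theorem let [n = 2 m + 2] and [k = ceil (n / 4)], so that [m] is
    [2 k - 2] or [2 k - 1].  The edges of [H] are the [k] pairs
    [{a_(2j), a_(2j+1)}] in [A = {a_0, ..., a_(m+1)}], and all edges between
    [A] and [B = {b_0, ..., b_(m-1)}] are present, except that the edges
    [a_i b_i] are removed when [m] is odd.  For [j < k] the pair
    [{a_(2j), a_(2j+1)}] is completed by sending [b_i] to [a_(i+j+1)], the index
    being taken modulo [m], where [a_(m+1)] and [a_m] stand in for [a_(2j)] and
    [a_(2j+1)].  The shifts [j + 1] are distinct modulo [m], and nonzero when
    [m] is odd; the replaced targets [a_(2j)] and [a_(2j+1)] are those of
    [b_(j-1)] and [b_j], again distinct for distinct [j].  Hence these
    [k] matchings are disjoint and avoid the removed edges. *)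

Require Import Defs.
From mathcomp Require Import all_boot.
From mathcomp Require Import zify.

Set Implicit Arguments.
Unset Strict Implicit.
Unset Printing Implicit Defensive.

Lemma sum_card_setI (T : finType) (P : {set {set T}}) (S : {set T}) :
  trivIset P -> \sum_(X in P) #|X :&: S| = #|cover P :&: S|.
Proof.
have card_setI (X : {set T}) : #|X :&: S| = \sum_(x in X) (x \in S).
  by rewrite -sum1_card -big_mkcondr; apply: eq_bigl => x; rewrite inE.
by move=> tiP; rewrite card_setI big_trivIset //=; apply: eq_bigr => X _.
Qed.

Lemma trivIset_card_hitting (T : finType) (P : {set {set T}}) (S : {set T}) :
  trivIset P -> (forall X, X \in P -> exists2 x, x \in X & x \in S) ->
  #|P| <= #|S|.
Proof.
move=> tiP hit; apply: leq_trans (subset_leq_card (subsetIr (cover P) S)).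
rewrite -sum_card_setI // -sum1_card; apply: leq_sum => X /hit[x Xx Sx].
by apply/card_gt0P; exists x; rewrite inE Xx.
Qed.

Lemma card_ord_neq (n x : nat) : #|[set i : 'I_n | x != i]| = n - (x < n).
Proof.
have [ltxn | lenx] := ltnP x n.
  have -> : [set i : 'I_n | x != i] = [set~ Ordinal ltxn].
    by apply/setP=> i; rewrite !inE -val_eqE /= eq_sym.
  by rewrite cardsC1 card_ord subn1.
have -> : [set i : 'I_n | x != i] = setT.
  by apply/setP=> i; rewrite !inE neq_ltn (leq_trans (ltn_ord i) lenx) orbT.
by rewrite cardsT card_ord subn0.
Qed.

Lemma modn_lt_double d i : i < d.*2 -> i %% d = if i < d then i else i - d.
Proof.
move=> lti2d; have [/modn_small // | ledi] := ltnP i d.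
by rewrite -{1}(subnK ledi) modnDr modn_small //; lia.
Qed.

(** * Perfect matchings *)

Lemma edgesP (G : sgraph) (e : {set G}) :
  reflect (exists x y : G, adj x y /\ e = [set x; y]) (e \in edges G).
Proof.
apply: (iffP imset2P) => [[x y _] | [x [y [xy ->]]]].
  by rewrite inE => /andP[_ xy] ->; exists x, y.
by exists x y => //; rewrite inE /= xy.
Qed.

Lemma card_edge (G : sgraph) (e : {set G}) : e \in edges G -> #|e| = 2.
Proof.
case/edgesP=> x [y [xy ->]]; rewrite cards2; have [eq_xy|//] := eqVneq x y.
by rewrite eq_xy adj_irr in xy.
Qed.

Lemma perfect_matching_card (G : sgraph) (M : {set {set G}}) :
  M \subset edges G -> cover M = [set: G] -> #|M|.*2 <= #|G| ->
  perfect_matching M.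
Proof.
move=> sME covM leMG; rewrite /perfect_matching sME covM eqxx andbT /=.
have [_ <-] := leq_card_cover M; rewrite eqn_leq leq_card_cover covM cardsT.
rewrite (leq_trans _ leMG) // -mul2n mulnC -sum_nat_const.
by apply: leq_sum => e /(subsetP sME)/card_edge->.
Qed.

Lemma perfect_matching_inner_edge (G : sgraph) (A : {set G})
    (M : {set {set G}}) :
  #|~: A| < #|A| -> perfect_matching M -> exists2 e, e \in M & e \subset A.
Proof.
move=> ltCA /and3P[/subsetP sME tiM /eqP covM].
have card_sum_edges (S : {set G}) : #|S| = \sum_(e in M) #|e :&: S|.
  by rewrite sum_card_setI // covM setTI.
apply/exists_inP; apply: contraTT ltCA => /exists_inPn outM; rewrite -leqNgt.
rewrite (card_sum_edges A) (card_sum_edges (~: A)); apply: leq_sum => e Me.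
rewrite -setDE; have := cardsID A e; rewrite (card_edge (sME _ Me)).
by have := outM e Me; rewrite -setD_eq0 -card_gt0; lia.
Qed.

Lemma max_disjoint_perfect_matchings_leq (G : sgraph) (A : {set G}) :
  #|~: A| < #|A| ->
  max_disjoint_perfect_matchings G <= #|[set e in edges G | e \subset A]|.
Proof.
move=> ltCA; apply/bigmax_leqP=> F /andP[/forall_inP pmF tiF].
apply: trivIset_card_hitting => // M /pmF pmM.
have [e Me sAe] := perfect_matching_inner_edge ltCA pmM; exists e => //.
by have /and3P[/subsetP sME _ _] := pmM; rewrite inE sME.
Qed.

Lemma leq_max_disjoint_perfect_matchings (G : sgraph) (I : finType)
    (M : I -> {set {set G}}) :
  (forall i, perfect_matching (M i)) -> (forall i, M i != set0) ->
  (forall i j e, e \in M i -> e \in M j -> i = j) ->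
  #|I| <= max_disjoint_perfect_matchings G.
Proof.
move=> pmM M_neq0 M_common.
have [] := @trivIimset _ _ predT M.
- move=> i j _ _; apply: contraNT => /pred0Pn[e /andP[/= Mi Mj]].
  by rewrite (M_common _ _ _ Mi Mj).
- by apply/imsetP=> -[i _ /esym/eqP]; apply/negP.
move=> tiM M_inj; rewrite -(card_in_imset M_inj).
apply: leq_bigmax_cond; rewrite /disjoint_perfect_matchings tiM andbT.
by apply/forall_inP=> _ /imsetP[i _ ->].
Qed.

(** * Extending a graph by an independent set *)

Section IndependentExtension.
Variables (H : sgraph) (B : finType) (r : H -> B -> bool).

Definition ext_adj : rel (H + B) := fun u v =>
  match u, v with
  | inl x, inl y => adj x y
  | inl x, inr b | inr b, inl x => r x b
  | inr _, inr _ => false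
  end.

Lemma ext_adj_sym : symmetric ext_adj.
Proof. by move=> [x|b] [y|c] //=; rewrite adj_sym. Qed.

Lemma ext_adj_irr : irreflexive ext_adj.
Proof. by move=> [x|b] //=; rewrite adj_irr. Qed.

Definition indep_ext : sgraph := SGraph ext_adj_sym ext_adj_irr.

Lemma card_indep_ext_set (S : {set indep_ext}) :
  #|S| = #|[set x | inl x \in S]| + #|[set b | inr b \in S]|.
Proof. by rewrite -sum1_card big_sumType /= !sum1dep_card. Qed.

Lemma degree_indep_ext_inl (x : H) :
  degree (inl x : indep_ext) = degree x + #|[set b | r x b]|.
Proof.
rewrite /degree card_indep_ext_set.
by congr (_ + _); apply: eq_card => y; rewrite !inE.
Qed.

Lemma degree_indep_ext_inr (b : B) :
  degree (inr b : indep_ext) = #|[set x | r x b]|.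
Proof.
rewrite /degree card_indep_ext_set.
rewrite -[RHS]addn0 -(cards0 B).
by congr (_ + _); apply: eq_card => y; rewrite !inE.
Qed.

Lemma inl_edge (p : {set H}) :
  p \in edges H -> (inl @: p : {set indep_ext}) \in edges indep_ext.
Proof.
case/edgesP=> x [y [xy ->]]; apply/edgesP; exists (inl x), (inl y).
by rewrite imsetU1 imset_set1.
Qed.

Lemma cross_edge (x : H) (b : B) :
  r x b -> ([set inl x; inr b] : {set indep_ext}) \in edges indep_ext.
Proof. by move=> rxb; apply/edgesP; exists (inl x), (inr b). Qed.

Lemma inner_edges_indep_ext :
  [set e in edges indep_ext | e \subset inl @: [set: H]]
    \subset (fun p : {set H} => inl @: p) @: edges H.
Proof.
apply/subsetP=> e; rewrite inE => /andP[/edgesP[u [v [uv ->]]]].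
rewrite subUset !sub1set => /andP[/imsetP[x _ def_u] /imsetP[y _ def_v]].
move: uv; rewrite {}def_u {}def_v /= => xy.
apply/imsetP; exists [set x; y]; first by apply/edgesP; exists x, y.
by rewrite imsetU1 imset_set1.
Qed.

Lemma max_indep_ext_leq :
  #|B| < #|H| -> max_disjoint_perfect_matchings indep_ext <= #|edges H|.
Proof.
pose A : {set indep_ext} := inl @: [set: H].
have cardA : #|A| = #|H| by rewrite card_imset ?cardsT //; apply: inl_inj.
have cardCA : #|~: A| = #|B|.
  by apply: (@addnI #|A|); rewrite cardsC cardA /= card_sum.
move=> ltBH; apply: leq_trans (max_disjoint_perfect_matchings_leq (A := A) _) _.
  by rewrite cardA cardCA.
exact: leq_trans (subset_leq_card inner_edges_indep_ext) (leq_imset_card _ _).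
Qed.

Hypothesis card_H : #|H| = #|B|.+2.

Definition ext_matching (p : {set H}) (g : B -> H) : {set {set indep_ext}} :=
  (inl @: p) |: [set [set inl (g b); inr b] | b in B].

Lemma ext_matching_perfect (p : {set H}) (g : B -> H) :
  p \in edges H -> injective g -> (forall b, g b \notin p) ->
  (forall b, r (g b) b) -> perfect_matching (ext_matching p g).
Proof.
move=> Ep g_inj gNp rg.
have image_g : g @: B = ~: p.
  apply/eqP; rewrite eqEcard; apply/andP; split.
    by apply/subsetP=> _ /imsetP[b _ ->]; rewrite inE.
  by have := cardsC p; rewrite card_imset // (card_edge Ep) card_H => -[<-].
apply: perfect_matching_card.
- rewrite subUset sub1set inl_edge //=.
  by apply/subsetP=> _ /imsetP[b _ ->]; apply: cross_edge.
- have cross b : [set inl (g b); inr b] \in ext_matching p g.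
    by apply/setU1r/imset_f.
  apply/setP=> v; rewrite [RHS]inE; apply/bigcupP; case: v => [x|b].
    have [px | pNx] := boolP (x \in p).
      by exists (inl @: p); rewrite ?setU11 ?imset_f.
    have: x \in g @: B by rewrite image_g inE.
    by case/imsetP=> b _ ->; exists [set inl (g b); inr b]; rewrite ?set21.
  by exists [set inl (g b); inr b]; rewrite ?set22.
have -> : #|indep_ext| = #|B|.+1.*2 by rewrite card_sum card_H doubleS -addnn.
by rewrite leq_double cardsU1 -add1n leq_add ?leq_b1 ?leq_imset_card.
Qed.

Lemma ext_matching_common_edge (p q : {set H}) (g h : B -> H)
    (e : {set indep_ext}) :
  e \in ext_matching p g -> e \in ext_matching q h ->
  p = q \/ exists b, g b = h b.
Proof.
have inr_inl b (s : {set H}) : inr b \notin (inl @: s : {set indep_ext}).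
  by apply/imsetP=> -[].
case/setU1P=> [-> | /imsetP[b _ ->]] /setU1P[|/imsetP[c _]] eq_e.
- by left; apply: imset_inj eq_e; apply: inl_inj.
- by have := inr_inl c p; rewrite eq_e set22.
- by have := inr_inl b q; rewrite -eq_e set22.
right; exists b.
have : inr b \in [set inl (h c); inr c] by rewrite -eq_e set22.
rewrite !inE => /eqP[eq_bc].
have : inl (g b) \in [set inl (h c); inr c] by rewrite -eq_e set21.
by rewrite !inE orbF => /eqP[->]; rewrite eq_bc.
Qed.

Lemma leq_max_indep_ext (I : finType) (p : I -> {set H}) (g : I -> B -> H) :
  (forall i, p i \in edges H) -> injective p ->
  (forall i, injective (g i)) -> (forall i b, g i b \notin p i) ->
  (forall i b, r (g i b) b) -> (forall b, injective (g^~ b)) ->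
  #|I| <= max_disjoint_perfect_matchings indep_ext.
Proof.
move=> Ep p_inj g_inj gNp rg gb_inj.
pose M i := ext_matching (p i) (g i).
apply: (leq_max_disjoint_perfect_matchings (M := M)).
- by move=> i; apply: ext_matching_perfect.
- by move=> i; apply/set0Pn; exists (inl @: p i); rewrite setU11.
by move=> i j e ei /(ext_matching_common_edge ei)[/p_inj | [b /gb_inj]].
Qed.

End IndependentExtension.

(** * The graph of consecutive pairs *)

Section PairGraph.
Variable n : nat.

Definition pair_adj : rel 'I_n := fun u v => (u != v) && (u./2 == v./2).

Lemma pair_adj_sym : symmetric pair_adj.
Proof. by move=> u v; rewrite /pair_adj eq_sym [u./2 == _]eq_sym. Qed.

Lemma pair_adj_irr : irreflexive pair_adj.
Proof. by move=> u; rewrite /pair_adj eqxx. Qed.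

Definition pair_graph : sgraph := SGraph pair_adj_sym pair_adj_irr.

Definition pair_at (j : nat) : {set pair_graph} := [set u : 'I_n | u./2 == j].

Lemma adj_pair_at (u v : pair_graph) : adj u v -> [set u; v] = pair_at u./2.
Proof.
case/andP=> /negP; rewrite -val_eqE /= => uNv /eqP uv2.
by apply/setP=> w; rewrite !inE -!val_eqE /=; lia.
Qed.

Lemma pair_at_edge j : j < n./2 -> pair_at j \in edges pair_graph.
Proof.
move=> ltj; have lt0 : j.*2 < n by lia.
have lt1 : j.*2.+1 < n by lia.
have adj01 : adj (Ordinal lt0 : pair_graph) (Ordinal lt1).
  by rewrite /= /pair_adj -val_eqE /=; lia.
apply/edgesP; exists (Ordinal lt0), (Ordinal lt1); split=> //.
by rewrite adj_pair_at //= doubleK.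
Qed.

Lemma edges_pair_graph : edges pair_graph = [set pair_at j | j : 'I_(n./2)].
Proof.
apply/setP=> e; apply/idP/imsetP=> [|[j _ ->]]; last exact: pair_at_edge.
case/edgesP=> u [v [uv ->]].
have lt_u2 : u./2 < n./2.
  have := uv; rewrite /= /pair_adj -val_eqE /=.
  by have := ltn_ord u; have := ltn_ord v; lia.
by exists (Ordinal lt_u2); rewrite // adj_pair_at.
Qed.

Lemma pair_at_inj : injective (fun j : 'I_(n./2) => pair_at j).
Proof.
move=> i j eq_ij; have /card_gt0P[u pu] : 0 < #|pair_at i|.
  by rewrite (card_edge (pair_at_edge (ltn_ord i))).
have := pu; rewrite eq_ij inE => /eqP def_j.
by move: pu; rewrite inE def_j => /eqP/esym/val_inj.
Qed.

Lemma degree_pair_graph (v : pair_graph) : degree v = (v < n./2.*2).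
Proof.
have -> : degree v = #|pair_at v./2 :\ v|.
  by apply: eq_card => u; rewrite !inE /= /pair_adj eq_sym [v./2 == _]eq_sym.
have [ltv | lev] := ltnP.
  have lt_v2 : v./2 < n./2 by lia.
  have := cardsD1 v (pair_at v./2).
  by rewrite inE eqxx (card_edge (pair_at_edge lt_v2)) => -[].
apply/eqP; rewrite cards_eq0 setD_eq0; apply/subsetP=> u.
rewrite !inE -val_eqE /=.
by have := ltn_ord u; have := ltn_ord v; lia.
Qed.

End PairGraph.

(** * The extremal graph *)

Section ExtremalGraph.
Variable m : nat.
Local Notation k := (m.+2./2).

Definition cross_adj (x : pair_graph m.+2) (b : 'I_m) : bool :=
  ~~ odd m || (x != b :> nat).

Definition extremal_graph : sgraph := indep_ext cross_adj.

Lemma degree_extremal_graph (v : extremal_graph) :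
  degree v = k.*2.-1 \/ degree v = k.*2.
Proof.
have card_cross_adj n x :
    #|[set i : 'I_n | ~~ odd m || (x != i :> nat)]| = n - (odd m && (x < n)).
  have [om | em] /= := boolP (odd m); first exact: card_ord_neq.
  by rewrite subn0 -[RHS]card_ord -cardsT; apply: eq_card => i; rewrite !inE.
case: v => [x | b].
  rewrite degree_indep_ext_inl degree_pair_graph card_cross_adj.
  by have := ltn_ord x; lia.
rewrite degree_indep_ext_inr.
have -> : [set x | cross_adj x b]
    = [set x : 'I_m.+2 | ~~ odd m || (b != x :> nat)].
  by apply/setP=> x; rewrite !inE /cross_adj eq_sym.
by rewrite card_cross_adj; have := ltn_ord b; lia.
Qed.

Definition cross_mate (j i : nat) : nat :=
  let c := (i + j.+1) %% m in
  if c == j.*2 then m.+1 else if c == j.*2.+1 then m else c.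

Hypothesis m_gt1 : 1 < m.

Lemma modn_shift j i : j < k -> i < m ->
  (i + j.+1) %% m = if i + j.+1 < m then i + j.+1 else i + j.+1 - m.
Proof. by move=> ltj lti; apply: modn_lt_double; lia. Qed.

Lemma cross_mate_lt j i : j < k -> i < m -> cross_mate j i < m.+2.
Proof.
by move=> ltj lti; rewrite /cross_mate modn_shift //; do !case: ifP; lia.
Qed.

Lemma cross_mate_inj j i i' : j < k -> i < m -> i' < m ->
  cross_mate j i = cross_mate j i' -> i = i'.
Proof.
by move=> ltj lti lti'; rewrite /cross_mate !modn_shift //; do !case: ifP; lia.
Qed.

Lemma cross_mate_shift_inj i j j' : i < m -> j < k -> j' < k ->
  cross_mate j i = cross_mate j' i -> j = j'.
Proof.
by move=> lti ltj ltj'; rewrite /cross_mate !modn_shift //; do !case: ifP; lia.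
Qed.

Lemma cross_mate_half j i : j < k -> i < m -> (cross_mate j i)./2 != j.
Proof.
by move=> ltj lti; rewrite /cross_mate modn_shift //; do !case: ifP; lia.
Qed.

Lemma cross_mate_neq j i : odd m -> j < k -> i < m -> cross_mate j i != i.
Proof.
by move=> om ltj lti; rewrite /cross_mate modn_shift //; do !case: ifP; lia.
Qed.

Lemma max_extremal_graph : max_disjoint_perfect_matchings extremal_graph = k.
Proof.
apply/eqP; rewrite eqn_leq; apply/andP; split.
  apply: leq_trans (max_indep_ext_leq _ _) _; first by rewrite !card_ord.
  by rewrite edges_pair_graph (leq_trans (leq_imset_card _ _)) ?card_ord.
pose g (j : 'I_k) (b : 'I_m) : pair_graph m.+2 :=
  Ordinal (cross_mate_lt (ltn_ord j) (ltn_ord b)).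
pose p (j : 'I_k) := pair_at m.+2 j.
rewrite -[leqLHS]card_ord; apply: (leq_max_indep_ext _ (p := p) (g := g)).
- by rewrite !card_ord.
- by move=> j; apply: pair_at_edge.
- exact: pair_at_inj.
- move=> j b b' /(congr1 val) eq_mate; apply: val_inj.
  exact: cross_mate_inj (ltn_ord j) (ltn_ord b) (ltn_ord b') eq_mate.
- by move=> j b; rewrite inE cross_mate_half.
- move=> j b; rewrite /cross_adj; have [om | //] := boolP (odd m).
  exact: cross_mate_neq.
move=> b j j' /(congr1 val) eq_mate; apply: val_inj.
exact: cross_mate_shift_inj (ltn_ord b) (ltn_ord j) (ltn_ord j') eq_mate.
Qed.

End ExtremalGraph.

Theorem theorem3p4 (n : nat) (hn : 34 <= n) (heven : ~~ odd n) :
  exists G : sgraph,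
    [/\ #|G| = n,
        forall v : G, degree v = D n \/ degree v = D n + 1
      & max_disjoint_perfect_matchings G = ceil_div n 4].
Proof.
pose m := n./2.-1.
have def_n : n = m.+2 + m by rewrite /m; lia.
have def_k : ceil_div n 4 = m.+2./2 by rewrite /ceil_div def_n; lia.
exists (extremal_graph m); split.
- by rewrite card_sum !card_ord.
- by move=> v; have := degree_extremal_graph v; rewrite /D def_k; lia.
- by rewrite def_k max_extremal_graph // /m; lia.
Qed.
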